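(* Let $\mathfrak g$ be a free Lie algebra over $\mathbb K$. There is a natural bijection between the relative Lie algebra cohomology $H^2(\mathfrak g\oplus\mathfrak g,\mathfrak g;U\mathfrak g)$ and the space of quasi-derivations on $U\mathfrak g$ modulo the exact quasi-derivations. It is induced by sending a quasi-derivation $q$, with associated Fox pairing $\rho(a,b)=q(a)b+aq(b)-q(ab)$, to the class of $\omega_q\oplus c_\rho$, where $\omega_q(x)=q(x)$ for $x\in\mathfrak g$ and $c_\rho(v,w)=\rho(v_1,w_2)-\rho(w_1,v_2)$ for $v=v_1\oplus v_2$, $w=w_1\oplus w_2\in\mathfrak g\oplus\mathfrak g$.
   Context: $\mathbb K$ is a field of characteristic $0$. $U\mathfrak g$ is the enveloping algebra with augmentation $\varepsilon$. **Fox derivatives, quasi-derivations.** A linear map $\partial:U\mathfrak g\to U\mathfrak g$ is a left (resp. right) Fox derivative if $\partial(ab)=\partial(a)\varepsilon(b)+a\partial(b)$ (resp. $\partial(ab)=\partial(a)b+\varepsilon(a)\partial(b)$). A Fox pairing is a bilinear map $\rho:U\mathfrak g\times U\mathfrak g\to U\mathfrak g$ that is a left Fox derivative in the first variable and a right Fox derivative in the second. A linear map $q:U\mathfrak g\to U\mathfrak g$ is a quasi-derivation if $(a,b)\mapsto q(a)b+aq(b)-q(ab)$ is a Fox pairing. It is exact if $q=\partial_L+\partial_R$ with $\partial_L$ a left and $\partial_R$ a right Fox derivative. **Relative cohomology.** $\mathfrak g\oplus\mathfrak g$ acts on $U\mathfrak g$ by $(x\oplus y)\cdot a=xa-ay$,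 and $\mathfrak g$ acts through the diagonal $\Delta:\mathfrak g\to\mathfrak g\oplus\mathfrak g$, $\Delta(x)=x\oplus x$. $H^*(\mathfrak g\oplus\mathfrak g,\mathfrak g;U\mathfrak g)$ is the cohomology of the complex with $C^1=\mathrm{Hom}_{\mathbb K}(\mathfrak g\oplus\mathfrak g,U\mathfrak g)$ and, for $k\ge2$, $C^k=\mathrm{Hom}_{\mathbb K}(\bigwedge^{k-1}\mathfrak g,U\mathfrak g)\oplus\mathrm{Hom}_{\mathbb K}(\bigwedge^{k}(\mathfrak g\oplus\mathfrak g),U\mathfrak g)$, differential $\delta r=(-\Delta^*r)\oplus(-dr)$ on $C^1$ and $\delta(\omega\oplus c)=(d\omega-\Delta^*c)\oplus(-dc)$ on $C^k$, where $d$ is the Chevalley–Eilenberg differential, e.g. $d\omega(x,y)=x\cdot\omega(y)-y\cdot\omega(x)-\omega([x,y])$. *)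

(* Defs.v *)
From HB Require Import structures.
From mathcomp Require Import all_boot all_order all_algebra.
From mathcomp Require Import generic_quotient ring_quotient.
From mathcomp Require Import boolp classical_sets functions.

Set Implicit Arguments.
Unset Strict Implicit.
Unset Printing Implicit Defensive.

Import GRing.Theory.
Local Open Scope ring_scope.
Local Open Scope quotient_scope.

(* The quotient of a module by a submodule: the library's zmodType quotient,   *)
(* equipped with the induced scalar multiplication.                            *)

Section QuotientModule.
Variables (K : fieldType) (V : lmodType K) (S : submodClosed V).

(* submodClosed does not inherit from zmodClosed, which Quotient.quot expects *)
Definition quot_sub : {pred V} := S.

HB.instance Definition _ :=
  GRing.isZmodClosed.Build V quot_sub (GRing.submod_closedB (submodClosedP S)).

Definition quot_mod : Type := Quotient.quot quot_sub.

HB.instance Definition _ := Choice.on quot_mod.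
HB.instance Definition _ := EqQuotient.on quot_mod.
HB.instance Definition _ := GRing.Zmodule.on quot_mod.
HB.instance Definition _ := ZmodQuotient.on quot_mod.

Definition quot_scale (a : K) (x : quot_mod) : quot_mod :=
  \pi_quot_mod (a *: repr x).

Lemma quot_modP (x y : V) : reflect (\pi_quot_mod x = \pi y) (x - y \in S).
Proof.
have -> : (x - y \in S) = (x == y %[mod quot_mod]).
  exact: (Quotient.idealrBE quot_sub).
exact: eqP.
Qed.

Lemma pi_quot_scale a (x : V) : \pi_quot_mod (a *: x) = quot_scale a (\pi x).
Proof.
apply/quot_modP; rewrite -scalerBr rpredZ //.
by apply/quot_modP; rewrite reprK.
Qed.

Fact quot_scalerA a b x :
  quot_scale a (quot_scale b x) = quot_scale (a * b) x.
Proof.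
elim/quotW: x => x.
by rewrite -(pi_quot_scale b) -(pi_quot_scale a) -(pi_quot_scale (a * b)) scalerA.
Qed.

Fact quot_scale1r : left_id 1 quot_scale.
Proof. by elim/quotW => x; rewrite -(pi_quot_scale 1) scale1r. Qed.

Fact pi_quotD (x y : V) : \pi_quot_mod (x + y) = \pi x + \pi y.
Proof. exact: pi_addr. Qed.

Fact quot_scalerDr : right_distributive quot_scale +%R.
Proof.
move=> a; elim/quotW => x; elim/quotW => y.
by rewrite -pi_quotD -!(pi_quot_scale a) -pi_quotD scalerDr.
Qed.

Fact quot_scalerDl x : {morph quot_scale^~ x : a b / a + b}.
Proof.
move=> a b; elim/quotW: x => x /=.
rewrite -(pi_quot_scale a) -(pi_quot_scale b) -(pi_quot_scale (a + b)).
by rewrite -pi_quotD scalerDl.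
Qed.

HB.instance Definition _ := GRing.Zmodule_isLmodule.Build K quot_mod
  quot_scalerA quot_scale1r quot_scalerDr quot_scalerDl.

Definition quot_class (x : V) : quot_mod := \pi_quot_mod x.

Fact quot_class_is_linear : linear quot_class.
Proof. by move=> a x y; rewrite /quot_class pi_quotD (pi_quot_scale a). Qed.

HB.instance Definition _ :=
  GRing.isLinear.Build K V quot_mod _ quot_class quot_class_is_linear.

End QuotientModule.

HB.mixin Record isLieAlgebra (K : fieldType) g of GRing.Lmodule K g := {
  lie : g -> g -> g;
  lie_linear_l : forall y, linear (lie^~ y);
  lie_linear_r : forall x, linear (lie x);
  liexx : forall x, lie x x = 0;
  lie_jacobi : forall x y z,
    lie x (lie y z) + lie y (lie z x) + lie z (lie x y) = 0
}.

#[short(type="lieAlgType")]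
HB.structure Definition LieAlgebra (K : fieldType) :=
  {g of isLieAlgebra K g & GRing.Lmodule K g}.

Section DirectSum.
Variables (K : fieldType) (g h : lieAlgType K).

Definition sum_lie (v w : g * h) : g * h := (lie v.1 w.1, lie v.2 w.2).

Fact sum_lie_linear_l w : linear (sum_lie^~ w).
Proof. by move=> a v v'; congr pair; apply: lie_linear_l. Qed.

Fact sum_lie_linear_r v : linear (sum_lie v).
Proof. by move=> a w w'; congr pair; apply: lie_linear_r. Qed.

Fact sum_liexx v : sum_lie v v = 0.
Proof. by rewrite /sum_lie !liexx. Qed.

Fact sum_lie_jacobi u v w :
  sum_lie u (sum_lie v w) + sum_lie v (sum_lie w u) + sum_lie w (sum_lie u v)
  = 0.
Proof. by congr pair; apply: lie_jacobi. Qed.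

HB.instance Definition _ := isLieAlgebra.Build K (g * h)%type
  sum_lie_linear_l sum_lie_linear_r sum_liexx sum_lie_jacobi.
End DirectSum.

Definition lie_morphism (K : fieldType) (g h : lieAlgType K)
    (f : {linear g -> h}) : Prop :=
  forall x y, f (lie x y) = lie (f x) (f y).

(* Morphisms into an associative algebra with its commutator bracket *)
Definition lie_assoc_morphism (K : fieldType) (g : lieAlgType K) (A : algType K)
    (f : {linear g -> A}) : Prop :=
  forall x y, f (lie x y) = f x * f y - f y * f x.

Definition free_lie_on (K : fieldType) (X : Type) (g : lieAlgType K)
    (gen : X -> g) : Prop :=
  forall (h : lieAlgType K) (f : X -> h),
    exists F : {linear g -> h},
      [/\ lie_morphism F, forall x, F (gen x) = f x
        & forall F' : {linear g -> h},
            lie_morphism F' -> (forall x, F' (gen x) = f x) -> F' =1 F].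

Definition enveloping_algebra (K : fieldType) (g : lieAlgType K) (U : algType K)
    (iota : {linear g -> U}) : Prop :=
  lie_assoc_morphism iota /\
  forall (A : algType K) (f : {linear g -> A}), lie_assoc_morphism f ->
    exists F : {lrmorphism U -> A},
      (forall x, F (iota x) = f x) /\
      forall F' : {lrmorphism U -> A}, (forall x, F' (iota x) = f x) -> F' =1 F.

Definition augmentation (K : fieldType) (g : lieAlgType K) (U : algType K)
    (iota : {linear g -> U}) (eps : {lrmorphism U -> K^o}) : Prop :=
  forall x, eps (iota x) = 0.

Section QuasiDerivations.
Variables (K : fieldType) (U : algType K) (eps : {lrmorphism U -> K^o}).

Definition left_fox (D : U -> U) : Prop :=
  linear D /\ forall a b, D (a * b) = eps b *: D a + a * D b.

Definition right_fox (D : U -> U) : Prop :=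
  linear D /\ forall a b, D (a * b) = D a * b + eps a *: D b.

(* Bilinearity is part of left_fox and right_fox. *)
Definition fox_pairing (rho : U -> U -> U) : Prop :=
  (forall b, left_fox (rho^~ b)) /\ (forall a, right_fox (rho a)).

Definition assoc_pairing (q : U -> U) (a b : U) : U :=
  q a * b + a * q b - q (a * b).

Definition quasi_derivation (q : U -> U) : Prop :=
  linear q /\ fox_pairing (assoc_pairing q).

Definition exact_qder (q : U -> U) : Prop :=
  exists DL DR : U -> U, [/\ left_fox DL, right_fox DR & q = DL + DR].

Fact left_fox_submod a D D' :
  left_fox D -> left_fox D' -> left_fox (a *: D + D').
Proof.
move=> [Dl DM] [D'l D'M]; split=> [k x y|x y]; rewrite !fctE.
  by rewrite Dl D'l !scalerDr !scalerA [a * k]mulrC addrACA.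
rewrite DM D'M !scalerDr mulrDr -scalerAr !scalerA [a * _]mulrC.
by rewrite -!addrA; congr (_ + _); rewrite addrCA.
Qed.

Fact right_fox_submod a D D' :
  right_fox D -> right_fox D' -> right_fox (a *: D + D').
Proof.
move=> [Dl DM] [D'l D'M]; split=> [k x y|x y]; rewrite !fctE.
  by rewrite Dl D'l !scalerDr !scalerA [a * k]mulrC addrACA.
rewrite DM D'M !scalerDr mulrDl -scalerAl !scalerA [a * _]mulrC.
by rewrite addrACA.
Qed.

Fact left_fox0 : left_fox 0.
Proof. by split=> [k x y|x y]; rewrite /= ?scaler0 ?mulr0 addr0. Qed.

Fact right_fox0 : right_fox 0.
Proof. by split=> [k x y|x y]; rewrite /= ?scaler0 ?mul0r addr0. Qed.

Fact assoc_pairing0 : assoc_pairing 0 = fun _ => 0.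
Proof.
by apply/funext => a; apply/funext => b; rewrite /assoc_pairing mulr0 mul0r !addr0 subrr.
Qed.

Fact assoc_pairingP k (q q' : U -> U) a b : assoc_pairing (k *: q + q') a b =
  k *: assoc_pairing q a b + assoc_pairing q' a b.
Proof.
rewrite /assoc_pairing !fctE !scalerDr !scalerN mulrDl mulrDr -scalerAl -scalerAr.
by rewrite opprD [X in X + _]addrACA [LHS]addrACA.
Qed.

Fact qder_submod : submod_closed [pred q | `[< quasi_derivation q >]].
Proof.
split=> [|k q q']; rewrite !inE;
  last move=> [ql [qL qR]] [q'l [q'L q'R]].
  split; first by move=> k x y; rewrite /= scaler0 addr0.
  by rewrite assoc_pairing0; split=> c; [exact: left_fox0 | exact: right_fox0].
split.
  by move=> j x y; rewrite !fctE ql q'l !scalerDr !scalerA [k * j]mulrC addrACA.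
split=> [b|a].
  rewrite (_ : (assoc_pairing (k *: q + q'))^~ b =
    k *: (assoc_pairing q)^~ b + (assoc_pairing q')^~ b); last first.
    by apply/funext => a; rewrite assoc_pairingP.
  exact: left_fox_submod.
rewrite (_ : assoc_pairing (k *: q + q') a =
  k *: assoc_pairing q a + assoc_pairing q' a); last first.
  by apply/funext => b; rewrite assoc_pairingP.
exact: right_fox_submod.
Qed.

Definition qder_pred : {pred U -> U} := [pred q | `[< quasi_derivation q >]].

HB.instance Definition _ := GRing.isSubmodClosed.Build K (U -> U) qder_pred
  (GRing.submod_closed_semi qder_submod).

Record qder := Qder { qder_fun :> U -> U; qder_funP : qder_fun \in qder_pred }.

HB.instance Definition _ := [isSub for qder_fun].
HB.instance Definition _ := [Choice of qder by <:].
HB.instance Definition _ := [SubChoice_isSubLmodule of qder by <:].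

Fact exact_submod :
  submod_closed [pred q : qder | `[< exact_qder q >]].
Proof.
split=> [|k q q']; rewrite !inE;
  last move=> [DL [DR [DLP DRP qE]]] [DL' [DR' [DLP' DRP' qE']]].
  exists 0, 0; split; [exact: left_fox0|exact: right_fox0|].
  by rewrite addr0; apply: (raddf0 (val : qder -> _)).
exists (k *: DL + DL'), (k *: DR + DR').
split; [exact: left_fox_submod|exact: right_fox_submod|].
rewrite (_ : qder_fun (k *: q + q') = k *: qder_fun q + qder_fun q').
  by rewrite qE qE' scalerDr addrACA.
exact: (linearP (val : qder -> _)).
Qed.

Definition exact_pred : {pred qder} :=
  [pred q : qder | `[< exact_qder q >]].

HB.instance Definition _ := GRing.isSubmodClosed.Build K qder exact_pred
  (GRing.submod_closed_semi exact_submod).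

Definition qder_mod_exact : lmodType K := quot_mod exact_pred.

Definition qder_class (q : qder) : qder_mod_exact := quot_class exact_pred q.

End QuasiDerivations.

(* Linear maps Lambda^k L -> M are represented by alternating k-linear maps.   *)
(* ce_dk is the Chevalley-Eilenberg differential on k-cochains.                *)
Section ChevalleyEilenberg.
Variables (K : fieldType) (L : lieAlgType K) (M : lmodType K).

Definition alt_bilinear (c : L -> L -> M) : Prop :=
  [/\ forall y, linear (c^~ y), forall x, linear (c x) & forall x, c x x = 0].

Variable act : L -> M -> M.

Definition ce_d1 (w : L -> M) (x y : L) : M :=
  act x (w y) - act y (w x) - w (lie x y).

Definition ce_d2 (c : L -> L -> M) (x y z : L) : M :=
  act x (c y z) - act y (c x z) + act z (c x y)
  - c (lie x y) z + c (lie x z) y - c (lie y z) x.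

Fact alt_bilinear0 : alt_bilinear 0.
Proof. by split=> // y k u v; rewrite /= scaler0 addr0. Qed.

Fact alt_bilinear_submod k c c' :
  alt_bilinear c -> alt_bilinear c' -> alt_bilinear (k *: c + c').
Proof.
move=> [cl cr ca] [c'l c'r c'a].
split=> [y j u v|x j u v|x]; rewrite !fctE.
- by rewrite cl c'l !scalerDr !scalerA [k * j]mulrC addrACA.
- by rewrite cr c'r !scalerDr !scalerA [k * j]mulrC addrACA.
- by rewrite ca c'a scaler0 addr0.
Qed.

Hypothesis act_linear : forall x, linear (act x).

Fact ce_d1_linear : linear ce_d1.
Proof.
move=> k w w'; apply/funext => x; apply/funext => y.
rewrite /ce_d1 !fctE !act_linear !scalerDr !scalerN !opprD.
by rewrite [X in X + _]addrACA [LHS]addrACA.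
Qed.

Fact ce_d2_linear : linear ce_d2.
Proof.
move=> k c c'; apply/funext => x; apply/funext => y; apply/funext => z.
rewrite /ce_d2 !fctE !act_linear !scalerDr !scalerN !opprD.
rewrite [X in X + _ + _ + _ + _ = _]addrACA [X in X + _ + _ + _ = _]addrACA.
rewrite [X in X + _ + _ = _]addrACA [X in X + _ = _]addrACA.
by rewrite [LHS]addrACA.
Qed.

Hypothesis act_lie : forall x y a,
  act (lie x y) a = act x (act y a) - act y (act x a).

Fact ce_d2_d1 (r : L -> M) : linear r -> ce_d2 (ce_d1 r) = 0.
Proof.
move=> rl; apply/funext => x; apply/funext => y; apply/funext => z.
have actB v a b : act v (a - b) = act v a - act v b.
  by rewrite -[a - b]addrC -scaleN1r act_linear scaleN1r addrC.
have rD u v : r (u + v) = r u + r v.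
  by rewrite -[u]scale1r rl !scale1r.
have lieN (u v : L) : lie u v = - lie v u.
  apply/eqP; rewrite -addr_eq0; apply/eqP.
  have lieDl (a b c : L) : lie (a + b) c = lie a c + lie b c.
    by have := lie_linear_l c 1 a b; rewrite !scale1r.
  have lieDr (a b c : L) : lie a (b + c) = lie a b + lie a c.
    by have := lie_linear_r a 1 b c; rewrite !scale1r.
  by have := liexx (u + v); rewrite lieDl !lieDr !liexx add0r addr0.
have lieNr (u v : L) : lie u (- v) = - lie u v.
  by have := lie_linear_r u (-1) v 0; rewrite addr0 !scaleN1r => ->;
     rewrite (_ : lie u 0 = 0) ?addr0 //; have := lie_linear_r u (-1) 0 0;
     rewrite scaler0 addr0 scaleN1r addNr.
have jac : r (lie (lie x z) y) =
    r (lie (lie x y) z) + r (lie (lie y z) x).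
  have -> : lie (lie x z) y = lie y (lie z x).
    by rewrite lieN (lieN x z) lieNr opprK.
  rewrite -rD (lieN _ z) (lieN (lie y z) x); congr r.
  apply/eqP; rewrite -opprD -addr_eq0 addrC [X in X + _]addrC; apply/eqP.
  by rewrite -[RHS](lie_jacobi x y z) addrAC.
rewrite /ce_d2 /ce_d1 !actB !act_lie jac.
rewrite -[LHS]addr0 !(opprD, opprK) -!addrA.
set a := act x (act y (r z)); set b := act x (act z (r y)).
set c := act x (r (lie y z)); set d := act y (act x (r z)).
set e := act y (act z (r x)); set f := act y (r (lie x z)).
set h := act z (act x (r y)); set i := act z (act y (r x)).
set j := act z (r (lie x y)); set k := r (lie (lie x y) z).
set l := r (lie (lie y z) x).
rewrite ?(addrCA _ (- a)) ?(addrCA _ a) addNKr.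
rewrite ?(addrCA _ (- b)) ?(addrCA _ b) addNKr.
rewrite ?(addrCA _ (- c)) ?(addrCA _ c) addNKr.
rewrite ?(addrCA _ (- d)) ?(addrCA _ d) addNKr.
rewrite ?(addrCA _ (- e)) ?(addrCA _ e) addNKr.
rewrite ?(addrCA _ (- f)) ?(addrCA _ f) addNKr.
rewrite ?(addrCA _ (- h)) ?(addrCA _ h) addNKr.
rewrite ?(addrCA _ (- i)) ?(addrCA _ i) addNKr.
rewrite ?(addrCA _ (- j)) ?(addrCA _ j) addNKr.
rewrite ?(addrCA _ (- k)) ?(addrCA _ k) addNKr.
by rewrite ?(addrCA _ (- l)) ?(addrCA _ l) addNKr.
Qed.

End ChevalleyEilenberg.

(* Only C^1 -> C^2 -> C^3 is needed for the second cohomology of the relative  *)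
(* complex of (g (+) g, g) with coefficients in Ug. Cochain spaces are cut out *)
(* of the ambient modules pair2 and pair3 of pairs of arbitrary functions.     *)
Section RelativeCohomology.
Variables (K : fieldType) (g : lieAlgType K) (U : algType K).
Variable iota : {linear g -> U}.

Definition bimod_act (v : g * g) (a : U) : U := iota v.1 * a - a * iota v.2.

Definition diag (x : g) : g * g := (x, x).

Definition diag_act (x : g) (a : U) : U := bimod_act (diag x) a.

Definition pair2 : lmodType K := ((g -> U) * (g * g -> g * g -> U))%type.

Definition pair3 : lmodType K :=
  ((g -> g -> U) * (g * g -> g * g -> g * g -> U))%type.

Definition cochain1 (r : g * g -> U) : Prop := linear r.

Definition cochain2 (z : pair2) : Prop := linear z.1 /\ alt_bilinear z.2.

Definition delta1 (r : g * g -> U) : pair2 :=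
  (- (fun x => r (diag x)), - ce_d1 bimod_act r).

Definition delta2 (z : pair2) : pair3 :=
  (ce_d1 diag_act z.1 - (fun x y => z.2 (diag x) (diag y)),
   - ce_d2 bimod_act z.2).

Definition cocycle2 (z : pair2) : Prop := cochain2 z /\ delta2 z = 0.

Definition coboundary2 (z : pair2) : Prop :=
  exists2 r : g * g -> U, cochain1 r & z = delta1 r.

Fact bimod_act_linear v : linear (bimod_act v).
Proof.
move=> k a b; rewrite /bimod_act mulrDl mulrDr -scalerAl -scalerAr.
by rewrite scalerBr opprD addrACA.
Qed.

Fact diag_act_linear x : linear (diag_act x).
Proof. exact: bimod_act_linear. Qed.

Fact delta1_linear : linear delta1.
Proof.
move=> k r r'; rewrite /delta1 (ce_d1_linear bimod_act_linear).
by congr pair; rewrite /= scalerN -opprD.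
Qed.

Fact delta2_linear : linear delta2.
Proof.
move=> k z z'; rewrite /delta2 (ce_d1_linear diag_act_linear).
rewrite (ce_d2_linear bimod_act_linear).
congr pair; rewrite /=; last by rewrite scalerN -opprD.
apply/funext => x; apply/funext => y.
by rewrite !fctE [in RHS]scalerBr [RHS]addrACA -opprD.
Qed.

Fact bimod_act_linear_l a : linear (bimod_act^~ a).
Proof.
move=> k v w; rewrite /bimod_act /= !linearP mulrDl mulrDr -scalerAl -scalerAr.
by rewrite scalerBr opprD addrACA.
Qed.

Fact bimod_act_lie v w a : lie_assoc_morphism iota ->
  bimod_act (lie v w) a =
  bimod_act v (bimod_act w a) - bimod_act w (bimod_act v a).
Proof.
move=> iotaM; rewrite /bimod_act /= !iotaM !mulrBr !mulrBl !mulrA.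
rewrite -[LHS]addr0 -[RHS]addr0 !(opprD, opprK) -!addrA; congr (_ + _).
set b := iota v.1 * a * iota w.2; set c := iota w.1 * a * iota v.2.
rewrite ?(addrCA _ (- b)) ?(addrCA _ b) addNKr.
rewrite ?(addrCA _ (- c)) ?(addrCA _ c) addNKr.
by rewrite [RHS]addrCA; congr (_ + _); rewrite [RHS]addrCA.
Qed.

Fact coboundary2_cocycle2 z :
  lie_assoc_morphism iota -> coboundary2 z -> cocycle2 z.
Proof.
move=> iotaM [r rl ->]; split; last first.
  rewrite /delta2 /delta1 /=; congr pair.
    apply/funext => x; apply/funext => y.
    rewrite /= !fctE /ce_d1 /diag_act.
    have actN v u : bimod_act v (- u) = - bimod_act v u.
      by rewrite /bimod_act mulrN mulNr opprK opprB addrC.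
    rewrite !actN.
    rewrite [X in _ + X]opprK addrC [RHS](_ : _ = 0) //.
    rewrite (_ : r (lie (diag x) (diag y)) = r (diag (lie x y))) //.
    set A := bimod_act _ _; set B := bimod_act _ _; set C := r _.
    by apply/eqP; rewrite addr_eq0 !opprD !opprK.
  rewrite (_ : - ce_d1 _ _ = ce_d1 bimod_act (- r)); last first.
    have := ce_d1_linear bimod_act_linear (-1) r 0.
    rewrite addr0 !scaleN1r => ->.
    rewrite -[LHS]addr0; congr (_ + _).
    have := ce_d1_linear bimod_act_linear (-1) 0 0.
    by rewrite scaler0 addr0 scaleN1r addNr => ->.
  rewrite ce_d2_d1 ?oppr0 //.
  - exact: bimod_act_linear.
  - by move=> v w a; apply: bimod_act_lie.
  - move=> k v w; rewrite !fctE rl opprD scalerN //.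
split.
  by move=> k x y; rewrite /= !fctE (rl k (diag x) (diag y)) opprD scalerN.
split.
- move=> w k v v'; rewrite /= !fctE /ce_d1 rl lie_linear_l rl.
  rewrite (bimod_act_linear_l _ k) bimod_act_linear.
  rewrite scalerN !scalerBr -opprD; congr (- _).
  by rewrite !opprD [X in X + _ = _]addrACA [LHS]addrACA.
- move=> v k w w'; rewrite /= !fctE /ce_d1 rl lie_linear_r rl.
  rewrite (bimod_act_linear_l _ k) bimod_act_linear.
  rewrite scalerN !scalerBr -opprD; congr (- _).
  by rewrite !opprD [X in X + _ = _]addrACA [LHS]addrACA.
- move=> v; rewrite /= !fctE /ce_d1 liexx subrr sub0r opprK.
  by have := rl (-1) 0 0; rewrite scaler0 addr0 scaleN1r addNr.
Qed.

Fact cocycle2_submod : submod_closed [pred z | `[< cocycle2 z >]].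
Proof.
split=> [|k z z']; rewrite !inE.
  split.
    by split; [move=> j x y; rewrite /= scaler0 addr0|exact: alt_bilinear0].
  by have := delta2_linear (-1) 0 0; rewrite scaler0 addr0 scaleN1r addNr.
move=> [[zl za] z0] [[z'l z'a] z'0]; split.
  split; last exact: (alt_bilinear_submod k za z'a).
  by move=> j x y; rewrite /= !fctE zl z'l !scalerDr !scalerA [k * j]mulrC addrACA.
by rewrite delta2_linear z0 z'0 scaler0 addr0.
Qed.

Definition Z2_pred : {pred pair2} := [pred z | `[< cocycle2 z >]].

HB.instance Definition _ := GRing.isSubmodClosed.Build K pair2 Z2_pred
  (GRing.submod_closed_semi cocycle2_submod).

Record Z2 := MkZ2 { Z2_val :> pair2; Z2_valP : Z2_val \in Z2_pred }.

HB.instance Definition _ := [isSub for Z2_val].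
HB.instance Definition _ := [Choice of Z2 by <:].
HB.instance Definition _ := [SubChoice_isSubLmodule of Z2 by <:].

Fact coboundary2_submod : submod_closed [pred z : Z2 | `[< coboundary2 z >]].
Proof.
split=> [|k z z']; rewrite !inE.
  exists 0; first by move=> j x y; rewrite /= scaler0 addr0.
  rewrite (_ : Z2_val 0 = 0); last exact: (raddf0 (val : Z2 -> _)).
  by have := delta1_linear (-1) 0 0; rewrite scaler0 addr0 scaleN1r addNr => ->.
move=> [r rl zE] [r' r'l z'E]; exists (k *: r + r').
  by move=> j x y; rewrite !fctE rl r'l !scalerDr !scalerA [k * j]mulrC addrACA.
rewrite delta1_linear -zE -z'E.
exact: (linearP (val : Z2 -> _)).
Qed.

Definition B2_pred : {pred Z2} := [pred z : Z2 | `[< coboundary2 z >]].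

HB.instance Definition _ := GRing.isSubmodClosed.Build K Z2 B2_pred
  (GRing.submod_closed_semi coboundary2_submod).

Definition H2 : lmodType K := quot_mod B2_pred.

Definition H2_class (z : Z2) : H2 := quot_class B2_pred z.

Definition omega (q : U -> U) (x : g) : U := q (iota x).

Definition pairing_cochain (rho : U -> U -> U) (v w : g * g) : U :=
  rho (iota v.1) (iota w.2) - rho (iota w.1) (iota v.2).

End RelativeCohomology.

(* Main.v *)
From HB Require Import structures.
Require Import Defs.
From mathcomp Require Import all_boot all_order all_algebra.
From mathcomp Require Import generic_quotient.
From mathcomp Require Import boolp classical_sets functions.

Set Implicit Arguments.
Unset Strict Implicit.
Unset Printing Implicit Defensive.

Import GRing.Theory.
Local Open Scope ring_scope.

(** Maps such as Fox derivatives and quasi-derivations are sections of algebra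
    extensions of Ug by a bimodule, so by the universal property of Ug they are
    determined by their values on g, and prescribed values on g extend as soon
    as they are compatible with the bracket. In the same way freeness splits
    every Lie extension L (+) M of a free Lie algebra, whence H^2(L, M) = 0.
    Applied to the two summands of g (+) g, this vanishing allows one to change
    a relative cocycle omega (+) c by a coboundary so that c vanishes on
    g (+) 0 and on 0 (+) g. The cocycle condition then says that
    (x, y) |-> c(x (+) 0, 0 (+) y) extends to a Fox pairing rho, and that
    omega extends to a quasi-derivation with pairing rho. If the cocycle of a
    quasi-derivation is the coboundary of r, then the restrictions of -r to the
    two summands extend to Fox derivatives whose sum is the
    quasi-derivation. *)

(* Decides identities in abelian groups: everything is moved to the left-hand *)
(* side, flattened, and opposite terms are cancelled pairwise.                 *)
Ltac zmod_pull b t :=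
  match t with
  | ?x + ?r => let _ := match goal with _ => unify b x end in constr:(erefl t)
  | ?x + ?r => let p := zmod_pull b r in
               constr:(etrans (congr1 (+%R x) p) (addrCA x b _))
  end.

Lemma cancel_opp (V : zmodType) (b r s : V) :
  r = b + s -> s = 0 -> - b + r = 0.
Proof. by move=> -> ->; rewrite addr0 addNr. Qed.

Lemma cancel_add (V : zmodType) (b r s : V) :
  r = - b + s -> s = 0 -> b + r = 0.
Proof. by move=> -> ->; rewrite addr0 addrN. Qed.

Ltac zmod_cancel :=
  match goal with
  | |- - ?b + ?r = 0 => let p := zmod_pull b r in apply: (cancel_opp p)
  | |- ?b + ?r = 0 => let p := zmod_pull (- b) r in apply: (cancel_add p)
  end.

Lemma subr_eq0_start (V : zmodType) (x y : V) : x - y = 0 -> x = y.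
Proof. by move/eqP; rewrite subr_eq0 => /eqP. Qed.

(** The trailing 0 makes every term, the last one included, the left operand of a sum, which is the
    only shape that [zmod_pull] matches. *)
Lemma addr0_start (V : zmodType) (x : V) : x + 0 = 0 -> x = 0.
Proof. by rewrite addr0. Qed.

Ltac zmod :=
  apply: subr_eq0_start;
  rewrite ?(opprD, opprK, oppr0, sub0r, subr0, add0r, addr0);
  apply: addr0_start; rewrite -?addrA;
  repeat zmod_cancel; try by [].

Lemma addr_idem0 (V : zmodType) (x : V) : x + x = x -> x = 0.
Proof. by move/(congr1 (fun y => y - x)); rewrite addrK subrr. Qed.

(** * Consequences of linearity for plain functions *)

Section LinearProp.
Variables (K : fieldType) (V W : lmodType K) (f : V -> W).
Hypothesis fl : linear f.

Lemma linear_D x y : f (x + y) = f x + f y.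
Proof. by rewrite -[x]scale1r fl !scale1r. Qed.

Lemma linear_0 : f 0 = 0.
Proof. by have := fl (-1) 0 0; rewrite scaler0 addr0 scaleN1r addNr. Qed.

Lemma linear_Z a x : f (a *: x) = a *: f x.
Proof. by rewrite -[a *: x]addr0 fl linear_0 addr0. Qed.

Lemma linear_N x : f (- x) = - f x.
Proof. by rewrite -scaleN1r linear_Z scaleN1r. Qed.

Lemma linear_B x y : f (x - y) = f x - f y.
Proof. by rewrite linear_D linear_N. Qed.

End LinearProp.

(** * Bimodule extensions of an associative algebra and their sections *)

Section TwistedExtension.
Variables (K : fieldType) (U : algType K) (phi psi : {lrmorphism U -> U}).

(** Hochschild 2-cocycles with values in the bimodule [U], acted on through [phi] from the left and
    [psi] from the right. The pairs (id, eps), (eps, id) and (id, id) serve left Fox derivatives,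
    right Fox derivatives and quasi-derivations. *)
Record twisted_cocycle (tau : U -> U -> U) : Prop := TwistedCocycle {
  tau_linear_l : forall b, linear (tau^~ b);
  tau_linear_r : forall a, linear (tau a);
  tau11 : tau 1 1 = 0;
  tau_assoc : forall a b c,
    phi a * tau b c + tau a (b * c) = tau (a * b) c + tau a b * psi c
}.

Variables (tau : U -> U -> U) (tauP : twisted_cocycle tau).

Lemma tau1l a : tau 1 a = 0.
Proof.
have := tau_assoc tauP 1 1 a.
by rewrite rmorph1 !mul1r tau11 // mul0r addr0 => /addr_idem0.
Qed.

Lemma tau1r a : tau a 1 = 0.
Proof.
have := tau_assoc tauP a 1 1.
by rewrite rmorph1 !mulr1 tau11 // mulr0 add0r => /esym /addr_idem0.
Qed.

(* The extension of U by the bimodule U, with actions through phi and psi,   *)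
(* whose multiplicative sections a |-> (a, q a) are the maps q with           *)
(* q (a b) = phi a * q b + q a * psi b - tau a b.                             *)
Definition text of twisted_cocycle tau : Type := (U * U)%type.

HB.instance Definition _ := GRing.Lmodule.on (text tauP).

Definition text_one : text tauP := (1, 0).
Definition text_mul (u v : text tauP) : text tauP :=
  (u.1 * v.1, phi u.1 * v.2 + u.2 * psi v.1 - tau u.1 v.1).

(** In the second component, associativity is the cocycle identity [tau_assoc]. *)
Fact text_mulA : associative text_mul.
Proof.
move=> [a m] [b n] [c p]; congr pair; rewrite /= ?mulrA //.
rewrite !rmorphM !(mulrBr, mulrBl, mulrDr, mulrDl) !mulrA.
have := tau_assoc tauP a b c.
move/(canRL (addrK _)) => ->; zmod.
Qed.

Fact text_mul1l : left_id text_one text_mul.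
Proof.
by case=> a m; congr pair; rewrite /= ?mul1r // rmorph1 mul1r mul0r tau1l subr0 addr0.
Qed.

Fact text_mul1r : right_id text_one text_mul.
Proof.
by case=> a m; congr pair; rewrite /= ?mulr1 // rmorph1 mulr1 mulr0 tau1r subr0 add0r.
Qed.

Fact text_mulDl : left_distributive text_mul +%R.
Proof.
move=> [a m] [b n] [c p]; congr pair; rewrite /= ?mulrDl //.
by rewrite raddfD (linear_D (tau_linear_l tauP c)) !mulrDl /=; zmod.
Qed.

Fact text_mulDr : right_distributive text_mul +%R.
Proof.
move=> [a m] [b n] [c p]; congr pair; rewrite /= ?mulrDr //.
by rewrite raddfD (linear_D (tau_linear_r tauP a)) !mulrDr /=; zmod.
Qed.

Fact text_one_neq0 : text_one != 0.
Proof. by apply/eqP => -[/eqP]; rewrite oner_eq0. Qed.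

HB.instance Definition _ := GRing.Zmodule_isNzRing.Build (text tauP)
  text_mulA text_mul1l text_mul1r text_mulDl text_mulDr text_one_neq0.

Fact text_scaleAl (k : K) (u v : text tauP) : k *: text_mul u v = text_mul (k *: u) v.
Proof.
case: u v => [a m] [b n]; congr pair; rewrite /= ?scalerAl //.
rewrite linearZZ (linear_Z (tau_linear_l tauP b)) -!scalerAl.
by rewrite scalerBr scalerDr.
Qed.

HB.instance Definition _ :=
  GRing.Lmodule_isLalgebra.Build K (text tauP) text_scaleAl.

Fact text_scaleAr (k : K) (u v : text tauP) : k *: text_mul u v = text_mul u (k *: v).
Proof.
case: u v => [a m] [b n]; congr pair; rewrite /= ?scalerAr //.
rewrite linearZZ (linear_Z (tau_linear_r tauP a)) -!scalerAr.
by rewrite scalerBr scalerDr.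
Qed.

HB.instance Definition _ :=
  GRing.Lalgebra_isAlgebra.Build K (text tauP) text_scaleAr.

(** These are the linear maps whose Hochschild coboundary is [tau]. *)
Definition twisted_der (q : U -> U) : Prop :=
  linear q /\ forall a b, q (a * b) = phi a * q b + q a * psi b - tau a b.

Lemma twisted_der1 q : twisted_der q -> q 1 = 0.
Proof.
case=> _ qM; have := qM 1 1.
by rewrite !rmorph1 !(mulr1, mul1r) tau11 // subr0 => /esym /addr_idem0.
Qed.

Definition text_fst (u : text tauP) : U := u.1.

Fact text_fst_linear : linear text_fst. Proof. by []. Qed.
HB.instance Definition _ :=
  GRing.isLinear.Build K (text tauP) U _ text_fst text_fst_linear.
Fact text_fst_monoid : monoid_morphism text_fst. Proof. by []. Qed.
HB.instance Definition _ :=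
  GRing.isMonoidMorphism.Build (text tauP) U text_fst text_fst_monoid.

Definition text_lift q of twisted_der q : U -> text tauP := fun a => (a, q a).

Section Lift.
Variables (q : U -> U) (qP : twisted_der q).
Fact text_lift_linear : linear (text_lift qP).
Proof. by move=> k a b; rewrite /text_lift qP.1. Qed.
HB.instance Definition _ :=
  GRing.isLinear.Build K U (text tauP) _ (text_lift qP) text_lift_linear.
Fact text_lift_monoid : monoid_morphism (text_lift qP).
Proof.
split; first by rewrite /text_lift (twisted_der1 qP).
by move=> a b; rewrite /text_lift qP.2.
Qed.
HB.instance Definition _ :=
  GRing.isMonoidMorphism.Build U (text tauP) (text_lift qP) text_lift_monoid.
End Lift.

Variables (g : lieAlgType K) (iota : {linear g -> U}).
Hypothesis U_env : enveloping_algebra iota.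

(** Compatibility with the bracket makes x |-> (iota x, al x) a Lie morphism into the extension; the
    second component of the induced algebra morphism is [q]. *)
Lemma twisted_der_exists (al : g -> U) : linear al ->
  (forall x y, al (lie x y) =
     (phi (iota x) * al y + al x * psi (iota y) - tau (iota x) (iota y))
     - (phi (iota y) * al x + al y * psi (iota x) - tau (iota y) (iota x))) ->
  exists2 q, twisted_der q & forall x, q (iota x) = al x.
Proof.
move=> all alM.
pose f x : text tauP := (iota x, al x).
have fl : linear f by move=> k x y; rewrite /f linearP all.
pose fL := GRing.isLinear.Build K g (text tauP) _ f fl.
pose f' : {linear g -> text tauP} := HB.pack f fL.
have f'M : lie_assoc_morphism f'.
  by move=> x y; congr pair; [exact: U_env.1 | exact: alM].
have [F [FE _]] := U_env.2 _ f' f'M.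
have [G [_ GE]] := U_env.2 _ iota U_env.1.
(* The first component of [F] and the identity are both algebra morphisms extending [iota]. *)
have F1 a : (F a).1 = a.
  transitivity ((text_fst \o F) a) => //.
  rewrite (GE (text_fst \o F : {lrmorphism U -> U})); last by move=> x /=; rewrite FE.
  by rewrite -(GE idfun).
exists (fun a => (F a).2).
  split; first by move=> k a b; rewrite linearP.
  by move=> a b; rewrite rmorphM /= !F1.
by move=> x; rewrite FE.
Qed.

(** The sections a |-> (a, q a) and a |-> (a, q' a) are algebra morphisms with the same restriction
    to [g]. *)
Lemma twisted_der_inj q q' : twisted_der q -> twisted_der q' ->
  (forall x, q (iota x) = q' (iota x)) -> q =1 q'.
Proof.
move=> qP q'P qq' a.
pose h := text_lift qP \o iota.
have hM : lie_assoc_morphism h.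
  move=> x y; congr pair; rewrite /= U_env.1 //.
  by rewrite (linear_B qP.1) !qP.2.
have [F [_ FE]] := U_env.2 _ h hM.
have E := FE (text_lift qP) (fun=> erefl) a.
have E' : text_lift q'P a = F a by apply: FE => x; congr pair.
exact: (congr1 snd (etrans E (esym E'))).
Qed.

End TwistedExtension.

(** * Extending Fox derivatives, Fox pairings and quasi-derivations from g *)

Section FoxExtension.
Variables (K : fieldType) (g : lieAlgType K) (U : algType K).
Variables (iota : {linear g -> U}) (U_env : enveloping_algebra iota).
Variables (eps : {lrmorphism U -> K^o}) (eps_aug : augmentation iota eps).

(** The augmentation viewed as an endomorphism of [U], so that it can stand for [phi] or [psi]. *)
Definition eps_alg (a : U) : U := (eps a)%:A.

Fact eps_alg_linear : linear eps_alg.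
Proof. by move=> k a b; rewrite /eps_alg linearP scalerDl scalerA. Qed.

HB.instance Definition _ :=
  GRing.isLinear.Build K U U _ eps_alg eps_alg_linear.

Fact eps_alg_monoid : monoid_morphism eps_alg.
Proof.
split=> [|a b]; first by rewrite /eps_alg rmorph1 scale1r.
by rewrite /eps_alg rmorphM -scalerAl mul1r scalerA.
Qed.

HB.instance Definition _ :=
  GRing.isMonoidMorphism.Build U U eps_alg eps_alg_monoid.

Fact twisted_cocycle0 phi psi : @twisted_cocycle K U phi psi (fun _ _ => 0).
Proof.
split=> [_ k x y|_ k x y||a b c]; rewrite ?scaler0 ?addr0 //.
by rewrite mulr0 mul0r addr0.
Qed.

Let left0 := twisted_cocycle0 idfun eps_alg.
Let right0 := twisted_cocycle0 eps_alg idfun.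

Lemma eps_alg_iota x : eps_alg (iota x) = 0.
Proof. by rewrite /eps_alg eps_aug scale0r. Qed.

Lemma left_foxE D : left_fox eps D <-> twisted_der idfun eps_alg (fun _ _ => 0) D.
Proof.
split=> -[Dl DM]; split=> // a b; rewrite DM /eps_alg.
  by rewrite -scalerAr mulr1 subr0 addrC.
by rewrite -scalerAr mulr1 subr0 addrC.
Qed.

Lemma right_foxE D : right_fox eps D <-> twisted_der eps_alg idfun (fun _ _ => 0) D.
Proof.
split=> -[Dl DM]; split=> // a b; rewrite DM /eps_alg.
  by rewrite -scalerAl mul1r subr0 addrC.
by rewrite -scalerAl mul1r subr0 addrC.
Qed.

(** The augmentation kills [g], so the right action drops out and compatibility says that [al] is a
    1-cocycle for left multiplication. *)
Lemma left_fox_exists (al : g -> U) : linear al ->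
  (forall x y, al (lie x y) = iota x * al y - iota y * al x) ->
  exists2 D, left_fox eps D & forall x, D (iota x) = al x.
Proof.
move=> all alM; have [|D /left_foxE DP DE] := twisted_der_exists left0 U_env all.
  by move=> x y; rewrite alM /= !eps_alg_iota !mulr0 !addr0 !subr0.
by exists D.
Qed.

Lemma right_fox_exists (be : g -> U) : linear be ->
  (forall x y, be (lie x y) = be x * iota y - be y * iota x) ->
  exists2 D, right_fox eps D & forall x, D (iota x) = be x.
Proof.
move=> bel beM; have [|D /right_foxE DP DE] := twisted_der_exists right0 U_env bel.
  by move=> x y; rewrite beM /= !eps_alg_iota !mul0r !add0r !subr0.
by exists D.
Qed.

Lemma left_fox_inj D D' : left_fox eps D -> left_fox eps D' ->
  (forall x, D (iota x) = D' (iota x)) -> D =1 D'.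
Proof. by move=> /left_foxE DP /left_foxE; apply: twisted_der_inj. Qed.

Lemma right_fox_inj D D' : right_fox eps D -> right_fox eps D' ->
  (forall x, D (iota x) = D' (iota x)) -> D =1 D'.
Proof. by move=> /right_foxE DP /right_foxE; apply: twisted_der_inj. Qed.

Lemma left_fox_mulr D b : left_fox eps D -> left_fox eps (fun a => D a * b).
Proof.
move=> [Dl DM]; split=> [k x y|x y]; first by rewrite Dl mulrDl scalerAl.
by rewrite DM mulrDl scalerAl mulrA.
Qed.

Lemma right_fox_mull D a : right_fox eps D -> right_fox eps (fun b => a * D b).
Proof.
move=> [Dl DM]; split=> [k x y|x y]; first by rewrite Dl mulrDr scalerAr.
by rewrite DM mulrDr scalerAr mulrA.
Qed.

Lemma left_fox_comb k D D' : left_fox eps D -> left_fox eps D' ->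
  left_fox eps (fun a => k *: D a + D' a).
Proof. exact: left_fox_submod. Qed.

Lemma right_fox_comb k D D' : right_fox eps D -> right_fox eps D' ->
  right_fox eps (fun a => k *: D a + D' a).
Proof. exact: right_fox_submod. Qed.

(** Both sides of the cocycle identity expand to a rho(b, c) + rho(a, b) c + eps(b) rho(a, c). *)
Lemma fox_pairing_cocycle rho : fox_pairing eps rho ->
  @twisted_cocycle K U idfun idfun rho.
Proof.
move=> [rl rr]; split=> [b|a||a b c]; first by case: (rl b).
- by case: (rr a).
- have [_ M] := rl 1; have := M 1 1.
  by rewrite rmorph1 scale1r !mul1r => /esym /addr_idem0.
- rewrite (rl c).2 (rr a).2 /=.
  by zmod.
Qed.

Lemma fox_pairing_inj rho rho' : fox_pairing eps rho -> fox_pairing eps rho' ->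
  (forall x y, rho (iota x) (iota y) = rho' (iota x) (iota y)) ->
  forall a b, rho a b = rho' a b.
Proof.
move=> [rl rr] [r'l r'r] E a; apply: right_fox_inj => // y.
by apply: (left_fox_inj (rl _) (r'l _)).
Qed.

(** The first variable is extended for each fixed y in [g], then the second for each fixed a in
    [U]. *)
Lemma fox_pairing_exists (rho0 : g -> g -> U) :
  (forall y, linear (rho0^~ y)) -> (forall x, linear (rho0 x)) ->
  (forall x y z, rho0 (lie x y) z = iota x * rho0 y z - iota y * rho0 x z) ->
  (forall x y z, rho0 x (lie y z) = rho0 x y * iota z - rho0 x z * iota y) ->
  exists2 rho, fox_pairing eps rho &
    forall x y, rho (iota x) (iota y) = rho0 x y.
Proof.
move=> rl rr rlM rrM.
have /choice[L LP] y : exists D, left_fox eps D /\ forall x, D (iota x) = rho0 x y.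
  have [//|D DP DE] := @left_fox_exists (rho0^~ y) (rl y).
  by exists D.
(* [choice] selects each [L y] separately; how it depends on y is recovered from the uniqueness of
   left Fox derivatives. *)
have Ll a : linear (L^~ a).
  move=> k y z; apply: (left_fox_inj (LP _).1 (left_fox_comb k (LP y).1 (LP z).1)).
  by move=> x; rewrite !(LP _).2 rr.
have LM a x y : L (lie x y) a = L x a * iota y - L y a * iota x.
  have DP := left_fox_comb (-1) (left_fox_mulr (iota x) (LP y).1)
    (left_fox_mulr (iota y) (LP x).1).
  rewrite (left_fox_inj (LP _).1 DP) ?scaleN1r 1?addrC //.
  by move=> z; rewrite !(LP _).2 rrM scaleN1r addrC.
have /choice[rho rhoP] a : exists D, right_fox eps D /\ forall y, D (iota y) = L y a.
  by have [//|D DP DE] := @right_fox_exists (L^~ a) (Ll a); exists D.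
exists rho; last by move=> x y; rewrite (rhoP _).2 (LP _).2.
split=> [b|a]; last exact: (rhoP a).1.
(* Both sides of each law are right Fox derivatives in the second variable, so comparing them on [g]
   suffices, where they are values of [L z]. *)
split=> [k x y|x y].
  apply: (right_fox_inj (rhoP _).1 (right_fox_comb k (rhoP x).1 (rhoP y).1)).
  by move=> z; rewrite !(rhoP _).2 (LP z).1.1.
apply: (right_fox_inj (rhoP _).1
  (right_fox_comb (eps y) (rhoP x).1 (right_fox_mull x (rhoP y).1))).
by move=> z; rewrite !(rhoP _).2 (LP z).1.2.
Qed.

Lemma qder_twisted (q : U -> U) rho : twisted_der idfun idfun rho q <->
  linear q /\ forall a b, assoc_pairing q a b = rho a b.
Proof.
split=> -[ql qM]; split=> // a b.
  by rewrite /assoc_pairing qM /=; zmod.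
by rewrite -qM /assoc_pairing /=; zmod.
Qed.

Lemma quasi_derivation_inj q q' : quasi_derivation eps q ->
  quasi_derivation eps q' ->
  (forall x y, assoc_pairing q (iota x) (iota y) =
               assoc_pairing q' (iota x) (iota y)) ->
  (forall x, q (iota x) = q' (iota x)) -> q =1 q'.
Proof.
move=> [ql qP] [q'l q'P] E.
apply: (@twisted_der_inj K U idfun idfun _ (fox_pairing_cocycle qP) g iota) => //.
  exact/qder_twisted.
by apply/qder_twisted; split=> // a b; apply/esym/fox_pairing_inj.
Qed.

(** The condition on [om] is the relative cocycle equation d om = Delta^* c_rho. It is also what
    lets [om] extend to a section of the extension defined by [rho]. *)
Lemma quasi_derivation_exists (rho : U -> U -> U) (om : g -> U) :
  fox_pairing eps rho -> linear om ->
  (forall x y, om (lie x y) =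
     diag_act iota x (om y) - diag_act iota y (om x)
     - (rho (iota x) (iota y) - rho (iota y) (iota x))) ->
  exists q, [/\ quasi_derivation eps q,
    forall a b, assoc_pairing q a b = rho a b & forall x, q (iota x) = om x].
Proof.
move=> rhoP oml omM.
have [|q /qder_twisted[ql qE] qom] :=
  twisted_der_exists (fox_pairing_cocycle rhoP) U_env oml.
  by move=> x y; rewrite omM /diag_act /bimod_act /=; zmod.
exists q; split=> //; split=> //.
rewrite (_ : assoc_pairing q = rho) //.
by apply/funext => a; apply/funext => b.
Qed.

End FoxExtension.

(** * Abelian extensions of Lie algebras and vanishing of H^2 for free ones *)

Lemma alt_bilinearC (K : fieldType) (L : lieAlgType K) (M : lmodType K)
    (c : L -> L -> M) x y : alt_bilinear c -> c x y = - c y x.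
Proof.
move=> [cl cr ca]; have := ca (x + y).
rewrite (linear_D (cl _)) !(linear_D (cr _)) !ca add0r addr0 => /eqP.
by rewrite addr_eq0 => /eqP.
Qed.

Lemma lie_alt_bilinear (K : fieldType) (L : lieAlgType K) :
  alt_bilinear (@lie K L).
Proof. by split; [exact: lie_linear_l|exact: lie_linear_r|exact: liexx]. Qed.

Section LieExtension.
Variables (K : fieldType) (L : lieAlgType K) (M : lmodType K).

Record lie_cocycle (act : L -> M -> M) (c : L -> L -> M) : Prop := LieCocycle {
  act_linear_l : forall m, linear (act^~ m);
  act_linear_r : forall x, linear (act x);
  act_lieE : forall x y m,
    act (lie x y) m = act x (act y m) - act y (act x m);
  cocycle_alt : alt_bilinear c;
  cocycle_d2 : ce_d2 act c = 0
}.

Variables (act : L -> M -> M) (c : L -> L -> M) (cP : lie_cocycle act c).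

Definition lext of lie_cocycle act c : Type := (L * M)%type.

HB.instance Definition _ := GRing.Lmodule.on (lext cP).

(** The sign of [c] is such that a section x |-> (x, al x) preserves brackets exactly when d al =
    c. *)
Definition lext_lie (u v : lext cP) : lext cP :=
  (lie u.1 v.1, act u.1 v.2 - act v.1 u.2 - c u.1 v.1).

Fact lext_lie_linear_l v : linear (lext_lie^~ v).
Proof.
have [cl _ _] := cocycle_alt cP.
move=> k [x m] [y n]; congr pair; rewrite /= ?lie_linear_l //.
rewrite (act_linear_l cP) (act_linear_r cP) cl !scalerBr.
by zmod.
Qed.

Fact lext_lie_linear_r u : linear (lext_lie u).
Proof.
have [_ cr _] := cocycle_alt cP.
move=> k [x m] [y n]; congr pair; rewrite /= ?lie_linear_r //.
rewrite (act_linear_l cP) (act_linear_r cP) cr !scalerBr.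
by zmod.
Qed.

Fact lext_liexx u : lext_lie u u = 0.
Proof.
have [_ _ ca] := cocycle_alt cP.
by congr pair; rewrite /= ?liexx // ca subrr subr0.
Qed.

(** In the second component this is d c = 0 combined with the module law [act_lieE]. *)
Fact lext_lie_jacobi u v w :
  lext_lie u (lext_lie v w) + lext_lie v (lext_lie w u)
  + lext_lie w (lext_lie u v) = 0.
Proof.
case: u v w => [x m] [y n] [z p]; congr pair; rewrite /= ?lie_jacobi //.
have cC := alt_bilinearC _ _ (cocycle_alt cP).
have cNl a b : c (- a) b = - c a b.
  by have [cl _ _] := cocycle_alt cP; rewrite (linear_N (cl b)).
have /= := congr1 (fun f => f x y z) (cocycle_d2 cP).
rewrite /ce_d2 => /eqP; rewrite subr_eq0 => /eqP E.
rewrite !(linear_B (act_linear_r cP _)) !(act_lieE cP).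
rewrite (cC x (lie y z)) -E (cC y (lie z x)) (cC z (lie x y)) (cC z x).
rewrite (alt_bilinearC z x (lie_alt_bilinear L)) cNl.
rewrite (linear_N (act_linear_r cP _)).
by zmod.
Qed.

HB.instance Definition _ := isLieAlgebra.Build K (lext cP)
  lext_lie_linear_l lext_lie_linear_r lext_liexx lext_lie_jacobi.

Definition lext_fst (u : lext cP) : L := u.1.

Fact lext_fst_linear : linear lext_fst. Proof. by []. Qed.
HB.instance Definition _ :=
  GRing.isLinear.Build K (lext cP) L _ lext_fst lext_fst_linear.

(** Freeness lifts the generators to the extension. By uniqueness the lift is a section of the
    projection, and its second component is a primitive of [c]. *)
Lemma free_lie_H2 (X : Type) (gen : X -> L) : free_lie_on gen ->
  exists2 al : L -> M, linear al & forall x y, ce_d1 act al x y = c x y.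
Proof.
move=> L_free.
have [F [FM Fgen _]] := L_free (lext cP) (fun x => (gen x, 0)).
have [G [_ _ G_uniq]] := L_free L gen.
have F1 x : (F x).1 = x.
  transitivity ((lext_fst \o F) x) => //.
  rewrite (G_uniq (lext_fst \o F : {linear L -> L})).
  - by rewrite -(G_uniq idfun).
  - by move=> a b; rewrite /= FM.
  - by move=> a; rewrite /= Fgen.
exists (fun x => (F x).2); first by move=> k x y; rewrite linearP.
by move=> x y; rewrite /ce_d1 FM /= !F1; zmod.
Qed.

End LieExtension.

(** Serves to restrict a cocycle on the direct sum to each summand. *)
Lemma lie_cocycle_pullback (K : fieldType) (L L' : lieAlgType K) (M : lmodType K)
    (act : L -> M -> M) (c : L -> L -> M) (j : L' -> L) :
  linear j -> (forall x y, j (lie x y) = lie (j x) (j y)) ->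
  lie_cocycle act c ->
  lie_cocycle (fun x => act (j x)) (fun x y => c (j x) (j y)).
Proof.
move=> jl jM [al ar aM [cl cr ca] c0]; split=> //.
- by move=> m k x y; rewrite jl al.
- by move=> x y m; rewrite jM aM.
- split=> [y k u v|x k u v|x]; rewrite ?ca //.
    by rewrite jl cl.
  by rewrite jl cr.
apply/funext => x; apply/funext => y; apply/funext => z.
rewrite /ce_d2 !jM.
exact: (congr1 (fun f => f (j x) (j y) (j z)) c0).
Qed.

(** * Bijections and quotient representatives *)

Lemma inj_surj_bijective (A B : Type) (f : A -> B) :
  injective f -> (forall b, exists a, f a = b) -> bijective f.
Proof.
move=> fI /choice[h hK]; exists h => // a.
by apply: fI; rewrite hK.
Qed.

Lemma quot_class_surj (K : fieldType) (V : lmodType K) (S : submodClosed V)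
    (x : quot_mod S) :
  exists v, x = quot_class S v.
Proof. by elim/quotW: x => v; exists v. Qed.

(** * Relative cocycles attached to quasi-derivations *)

Section Comparison.
Variables (K : fieldType) (g : lieAlgType K) (U : algType K).
Variables (iota : {linear g -> U}) (U_env : enveloping_algebra iota).
Variables (eps : {lrmorphism U -> K^o}) (eps_aug : augmentation iota eps).

Lemma left_fox_lie D x y : left_fox eps D ->
  D (iota (lie x y)) = iota x * D (iota y) - iota y * D (iota x).
Proof.
move=> [Dl DM]; rewrite U_env.1 (linear_B Dl) !DM !eps_aug !scale0r.
by rewrite !add0r.
Qed.

Lemma right_fox_lie D x y : right_fox eps D ->
  D (iota (lie x y)) = D (iota x) * iota y - D (iota y) * iota x.
Proof.
move=> [Dl DM]; rewrite U_env.1 (linear_B Dl) !DM !eps_aug !scale0r.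
by rewrite !addr0.
Qed.

Lemma pairing_cochain_alt rho : fox_pairing eps rho ->
  alt_bilinear (pairing_cochain iota rho).
Proof.
move=> [rl rr]; rewrite /pairing_cochain.
split=> [w k v v'|v k w w'|v]; last exact: subrr.
  by rewrite /= !linearP (rl _).1 (rr _).1 scalerBr; zmod.
by rewrite /= !linearP (rl _).1 (rr _).1 scalerBr; zmod.
Qed.

Lemma pairing_cochain_d2 rho : fox_pairing eps rho ->
  ce_d2 (bimod_act iota) (pairing_cochain iota rho) = 0.
Proof.
move=> [rl rr]; apply/funext => u; apply/funext => v; apply/funext => w.
rewrite /ce_d2 /pairing_cochain /bimod_act /=.
rewrite !(fun b x y => left_fox_lie x y (rl b)).
rewrite !(fun a x y => right_fox_lie x y (rr a)).
by rewrite !(mulrBr, mulrBl); zmod.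
Qed.

(** In rho(x, y) - rho(y, x) the values q(xy) and q(yx) combine to q([x, y]), which leaves d omega
    for the diagonal action. *)
Lemma qder_cocycle2 (q : U -> U) : quasi_derivation eps q ->
  cocycle2 iota (omega iota q, pairing_cochain iota (assoc_pairing q)).
Proof.
move=> [ql qP]; split.
  split; last exact: pairing_cochain_alt.
  by move=> k x y; rewrite /= /omega linearP ql.
rewrite /delta2 /= pairing_cochain_d2 // oppr0; congr pair.
apply/funext => x; apply/funext => y; rewrite !fctE.
rewrite /ce_d1 /omega /pairing_cochain /assoc_pairing /diag_act /bimod_act /=.
by rewrite U_env.1 (linear_B ql); zmod.
Qed.

Lemma cocycle2_lie (z : pair2 g U) : cocycle2 iota z ->
  lie_cocycle (bimod_act iota) z.2.
Proof.
move=> [[_ alt] /(congr1 snd) /= /eqP]; rewrite oppr_eq0 => /eqP d2.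
split=> //.
- exact: bimod_act_linear_l.
- exact: bimod_act_linear.
- by move=> v w a; apply: bimod_act_lie U_env.1.
Qed.

(** * Exact quasi-derivations correspond to coboundaries *)

Lemma exact_qder_coboundary (q : U -> U) : exact_qder eps q ->
  coboundary2 iota (omega iota q, pairing_cochain iota (assoc_pairing q)).
Proof.
move=> [DL [DR [DLP DRP ->]]].
(* The minus signs offset those in [delta1]. *)
exists (fun v => - DL (iota v.1) - DR (iota v.2)).
  move=> k v w; rewrite /= !linearP DLP.1 DRP.1 scalerBr scalerN.
  by zmod.
congr pair.
  by apply/funext => x; rewrite /omega !fctE /=; zmod.
apply/funext => v; apply/funext => w.
rewrite -[RHS]/(- ce_d1 (bimod_act iota) _ v w).
rewrite /ce_d1 /pairing_cochain /assoc_pairing /bimod_act !fctE /=.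
rewrite (left_fox_lie _ _ DLP) (right_fox_lie _ _ DRP) !DLP.2 !DRP.2 !eps_aug.
rewrite !scale0r !(mulrDl, mulrDr, mulrBl, mulrBr, mulrN, mulNr).
by zmod.
Qed.

(** The map a |-> a - eps(a) is a Fox derivative on both sides; it is the second ingredient of the
    pairing of [DL + DR]. *)
Lemma aug_left_fox : left_fox eps (fun a => a - eps_alg eps a).
Proof.
split=> [k a b|a b]; first by rewrite linearP scalerBr opprD addrACA.
rewrite rmorphM /eps_alg scalerBr mulrBr -!scalerAr !mulr1 scalerA.
by rewrite [eps b * _]mulrC; zmod.
Qed.

Lemma aug_right_fox : right_fox eps (fun a => a - eps_alg eps a).
Proof.
split=> [k a b|a b]; first by rewrite linearP scalerBr opprD addrACA.
rewrite rmorphM /eps_alg scalerBr mulrBl -!scalerAl !mul1r scalerA.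
by zmod.
Qed.

Lemma exact_quasi_derivation DL DR : left_fox eps DL -> right_fox eps DR ->
  quasi_derivation eps (DL + DR).
Proof.
move=> DLP DRP; split; first by move=> k a b; rewrite !fctE DLP.1 DRP.1 scalerDr addrACA.
have E a b : assoc_pairing (DL + DR) a b =
    DL a * (b - eps_alg eps b) + (a - eps_alg eps a) * DR b.
  rewrite /assoc_pairing !fctE DLP.2 DRP.2 /eps_alg mulrBr !mulrBl -scalerAr.
  by rewrite -scalerAl mulr1 mul1r mulrDl mulrDr; zmod.
split=> [b|a].
  rewrite (_ : _^~ b = fun a => 1 *: (DL a * (b - eps_alg eps b))
     + (a - eps_alg eps a) * DR b); last first.
    by apply/funext => a; rewrite E scale1r.
  by apply: left_fox_comb; apply: left_fox_mulr => //; apply: aug_left_fox.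
rewrite (_ : assoc_pairing (DL + DR) a =
   fun b => 1 *: (DL a * (b - eps_alg eps b)) + (a - eps_alg eps a) * DR b);
  last by apply/funext => b; rewrite E scale1r.
by apply: right_fox_comb; apply: right_fox_mull => //; apply: aug_right_fox.
Qed.

Lemma coboundary_exact_qder (q : U -> U) : quasi_derivation eps q ->
  coboundary2 iota (omega iota q, pairing_cochain iota (assoc_pairing q)) ->
  exact_qder eps q.
Proof.
move=> qP [r rl E].
have Eq x : q (iota x) = - r (x, x).
  by have := congr1 (fun z => z.1 x) E.
have Erho v w : pairing_cochain iota (assoc_pairing q) v w =
    - ce_d1 (bimod_act iota) r v w.
  by have := congr1 (fun z => z.2 v w) E.
have [_ [rhol rhor]] := qP.
have rho0l a : assoc_pairing q 0 a = 0 by exact: (linear_0 (rhol a).1).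
have rho0r a : assoc_pairing q a 0 = 0 by exact: (linear_0 (rhor a).1).
have [|x y|DL DLP DLE] :=
    @left_fox_exists _ _ _ _ U_env _ eps_aug (fun x => - r (x, 0)).
- move=> k x y; rewrite (_ : (k *: x + y, 0) = k *: (x, 0) + (y, 0)).
    by rewrite rl opprD scalerN.
  by congr pair; rewrite /= scaler0 addr0.
(* Inside one summand each term of the pairing cochain has a zero argument, so the restriction of
   [r] is a 1-cocycle. *)
- have := Erho (x, 0) (y, 0).
  rewrite /pairing_cochain /ce_d1 /bimod_act /= raddf0 !rho0r subrr !mulr0 !subr0.
  rewrite (_ : lie (x, 0) (y, 0) = (lie x y, 0)); last by congr pair; apply: liexx.
  by move/esym/eqP; rewrite oppr_eq0 subr_eq0 => /eqP <-; rewrite !mulrN; zmod.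
have [|x y|DR DRP DRE] :=
    @right_fox_exists _ _ _ _ U_env _ eps_aug (fun x => - r (0, x)).
- move=> k x y; rewrite (_ : (0, k *: x + y) = k *: (0, x) + (0, y)).
    by rewrite rl opprD scalerN.
  by congr pair; rewrite /= scaler0 addr0.
- have := Erho (0, x) (0, y).
  rewrite /pairing_cochain /ce_d1 /bimod_act /= raddf0 !rho0l subrr !mul0r !sub0r.
  rewrite (_ : lie (0, x) (0, y) = (0, lie x y)); last by congr pair; apply: liexx.
  by move/esym/eqP; rewrite oppr_eq0 subr_eq0 => /eqP <-; rewrite !mulNr; zmod.
exists DL, DR; split=> //; apply/funext.
have exP := exact_quasi_derivation DLP DRP.
apply: (quasi_derivation_inj U_env qP exP) => [x y|x]; last first.
  rewrite !fctE DLE DRE Eq -opprD -(linear_D rl); congr (- r _).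
  by congr pair; rewrite /= ?addr0 ?add0r.
(* The two summands commute, so on mixed arguments the coboundary equation reads rho(x, y) = DL(x) y
   + x DR(y), the pairing of [DL + DR] on [g]. *)
have := Erho (x, 0) (0, y).
rewrite /pairing_cochain /= raddf0 rho0l subr0 => ->.
rewrite /ce_d1 /bimod_act /= raddf0 !mul0r !mulr0.
rewrite (_ : lie (x, 0) (0, y) = 0); last first.
  congr pair; rewrite /=; first exact: (linear_0 (lie_linear_r x)).
  exact: (linear_0 (lie_linear_l y)).
rewrite (linear_0 rl) /assoc_pairing !fctE DLP.2 DRP.2 !eps_aug !scale0r.
by rewrite !DLE !DRE !(mulrDl, mulrDr, mulNr, mulrN); zmod.
Qed.

(** * Normalizing a relative cocycle and reading off a quasi-derivation *)

Lemma normalized_cocycle_qder (z : pair2 g U) : cocycle2 iota z ->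
  (forall x y, z.2 (x, 0) (y, 0) = 0) -> (forall x y, z.2 (0, x) (0, y) = 0) ->
  exists2 q, quasi_derivation eps q
    & z = (omega iota q, pairing_cochain iota (assoc_pairing q)).
Proof.
move=> zP zl zr; have [[oml [cl cr ca]] d0] := zP; case: z => om c /= in zP zl zr oml cl cr ca d0 *.
have cC := fun v w => alt_bilinearC v w (And3 cl cr ca).
have dom x y : ce_d1 (diag_act iota) om x y = c (diag x) (diag y).
  by apply/eqP; rewrite -subr_eq0; apply/eqP/(congr1 (fun z => z.1 x y) d0).
have d2 := cocycle_d2 (cocycle2_lie zP); rewrite /= in d2.
have lie0 (x y : g) : lie ((x, 0) : g * g) (0, y) = 0.
  congr pair; rewrite /=; first exact: (linear_0 (lie_linear_r x)).
  exact: (linear_0 (lie_linear_l y)).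
have liel (x y : g) : lie ((x, 0) : g * g) (y, 0) = (lie x y, 0).
  by congr pair; apply: liexx.
have lier (x y : g) : lie ((0, x) : g * g) (0, y) = (0, lie x y).
  by congr pair; apply: liexx.
have c0l v : c 0 v = 0 by exact: (linear_0 (cl v)).
have [|||| rho rhoP rhoE] := @fox_pairing_exists _ _ _ _ U_env _ eps_aug
   (fun x y => c (x, 0) (0, y)).
- move=> y k x x'; rewrite -cl; congr (c _ _).
  by congr pair; rewrite /= scaler0 addr0.
- move=> x k y y'; rewrite -cr; congr (c _ _).
  by congr pair; rewrite /= scaler0 addr0.
(* Mixed brackets vanish, and so does [c] inside a summand; what remains of d c = 0 is the bracket
   law in the first variable. Two arguments in the other summand give the second variable. *)
- move=> x y w; have := congr1 (fun f => f (x, 0) (y, 0) (0, w)) d2.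
  rewrite /= /ce_d2 /bimod_act /= raddf0 liel !lie0 !c0l zl.
  rewrite !(mulr0, mul0r, subr0, addr0) => /eqP.
  by rewrite subr_eq0 => /eqP.
- move=> x y w; have := congr1 (fun f => f (x, 0) (0, y) (0, w)) d2.
  rewrite /= /ce_d2 /bimod_act /= raddf0 lier !lie0 !c0l zr (cC (0, lie y w)).
  rewrite !(mulr0, mul0r, subr0, addr0, sub0r, opprK) => E.
  by apply: subr_eq0_start; rewrite -[RHS]E; zmod.
(* After each argument is split into its two components, only the mixed values of [c] survive. *)
have cE v w : c v w = rho (iota v.1) (iota w.2) - rho (iota w.1) (iota v.2).
  rewrite !rhoE; case: v w => [v1 v2] [w1 w2] /=.
  have split1 (a b : g) : ((a, b) : g * g) = (a, 0) + (0, b).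
    by congr pair; rewrite /= ?addr0 ?add0r.
  rewrite (split1 v1) (split1 w1) (linear_D (cl _)) !(linear_D (cr _)) zl zr.
  by rewrite add0r addr0 (cC (0, v2)).
have [|q [qP qrho qom]] := quasi_derivation_exists U_env rhoP oml.
  move=> x y; rewrite /= -(cE (diag x) (diag y)) -dom /ce_d1.
  by zmod.
exists q => //; congr pair; first by apply/funext => x; rewrite /omega qom.
by apply/funext => v; apply/funext => w; rewrite /pairing_cochain !qrho cE.
Qed.

Lemma cocycle_cohomologous_qder (X : Type) (gen : X -> g) (z : pair2 g U) :
  free_lie_on gen -> cocycle2 iota z ->
  exists2 q, quasi_derivation eps q & coboundary2 iota
    ((omega iota q, pairing_cochain iota (assoc_pairing q)) - z : pair2 g U).
Proof.
move=> g_free zP; have zL := cocycle2_lie zP.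
pose j1 (x : g) : g * g := (x, 0); pose j2 (x : g) : g * g := (0, x).
have j1l : linear j1.
  by move=> k x y; congr pair; rewrite /= scaler0 addr0.
have j2l : linear j2.
  by move=> k x y; congr pair; rewrite /= scaler0 addr0.
have j1M x y : j1 (lie x y) = lie (j1 x) (j1 y).
  by congr pair; rewrite /= liexx.
have j2M x y : j2 (lie x y) = lie (j2 x) (j2 y).
  by congr pair; rewrite /= liexx.
have [al all alE] := free_lie_H2 (lie_cocycle_pullback j1l j1M zL) g_free.
have [be bel beE] := free_lie_H2 (lie_cocycle_pullback j2l j2M zL) g_free.
(* Gluing the primitives of [c] on the two summands yields a cochain for which c - d r vanishes on
   each of them. *)
pose r (v : g * g) := al v.1 + be v.2.
have rl : linear r by move=> k v w; rewrite /r /= all bel scalerDr addrACA.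
have z'P : cocycle2 iota (1 *: z + delta1 iota r).
  have [_ /(_ 1 z (delta1 iota r))] := cocycle2_submod iota.
  rewrite !inE; apply=> //.
  by apply: coboundary2_cocycle2; [exact: U_env.1 | exists r].
have r1 x : r (j1 x) = al x by rewrite /r /= (linear_0 bel) addr0.
have r2 x : r (j2 x) = be x by rewrite /r /= (linear_0 all) add0r.
have [x y|x y|q qP qE] := normalized_cocycle_qder z'P.
- rewrite scale1r -[LHS]/(z.2 (j1 x) (j1 y) - ce_d1 (bimod_act iota) r (j1 x) (j1 y)).
  by rewrite -alE /ce_d1 -j1M !r1 subrr.
- rewrite scale1r -[LHS]/(z.2 (j2 x) (j2 y) - ce_d1 (bimod_act iota) r (j2 x) (j2 y)).
  by rewrite -beE /ce_d1 -j2M !r2 subrr.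
exists q => //; exists r => //.
by rewrite -qE scale1r addrC addKr.
Qed.

(** * The induced linear map on quotients and its bijectivity *)

Fact qder_cochain_subproof (q : qder eps) :
  ((omega iota q, pairing_cochain iota (assoc_pairing q)) : pair2 g U)
    \in Z2_pred iota.
Proof.
by rewrite inE; apply: qder_cocycle2; apply/asboolP; apply: qder_funP.
Qed.

Definition qder_cochain (q : qder eps) : Z2 iota :=
  MkZ2 (qder_cochain_subproof q).

Fact qder_cochain_linear : linear qder_cochain.
Proof.
move=> k q q'; apply: val_inj.
rewrite [RHS](linearP (val : Z2 iota -> _)) /=.
have E : qder_fun (k *: q + q') = k *: qder_fun q + qder_fun q'.
  exact: (linearP (val : qder eps -> _)).
apply: etrans (congr1 (fun f : U -> U =>
  (omega iota f, pairing_cochain iota (assoc_pairing f)) : pair2 g U) E) _.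
congr pair; apply/funext => v.
apply/funext => w.
rewrite -[RHS]/(k *: pairing_cochain iota (assoc_pairing q) v w
   + pairing_cochain iota (assoc_pairing q') v w).
by rewrite /pairing_cochain !assoc_pairingP /assoc_pairing !(scalerDr, scalerN); zmod.
Qed.

HB.instance Definition _ :=
  GRing.isLinear.Build K (qder eps) (Z2 iota) _ qder_cochain qder_cochain_linear.

(** One direction makes the map well defined on classes, the other makes it injective. *)
Lemma qder_cochain_exact q :
  (qder_cochain q \in @B2_pred K g U iota) = (q \in @exact_pred K U eps).
Proof.
rewrite !inE; apply/asboolP/asboolP => [|qE]; last exact: exact_qder_coboundary.
apply: coboundary_exact_qder.
by apply/asboolP; apply: qder_funP.
Qed.

Definition qder_H2 (x : qder_mod_exact eps) : H2 iota :=
  H2_class (qder_cochain (repr x)).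

(** The representative chosen by [repr] differs from [q] by an exact quasi-derivation, whose cochain
    is a coboundary. *)
Lemma qder_H2_class q : qder_H2 (qder_class q) = H2_class (qder_cochain q).
Proof.
apply/quot_modP; rewrite -raddfB qder_cochain_exact.
by apply/quot_modP; rewrite reprK.
Qed.

Fact qder_H2_linear : linear qder_H2.
Proof.
move=> k x y; have [q ->] := quot_class_surj x.
have [q' ->] := quot_class_surj y.
rewrite -linearP !qder_H2_class linearP.
exact: linearP.
Qed.

HB.instance Definition _ :=
  GRing.isLinear.Build K (qder_mod_exact eps) (H2 iota) _ qder_H2 qder_H2_linear.

Lemma qder_H2_inj : injective qder_H2.
Proof.
move=> x y; have [q ->] := quot_class_surj x.
have [q' ->] := quot_class_surj y.
rewrite !qder_H2_class => /quot_modP; rewrite -raddfB qder_cochain_exact => E.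
exact/quot_modP.
Qed.

(** Freeness enters through the normalization of a representing cocycle, which replaces it by that
    of a quasi-derivation. *)
Lemma qder_H2_surj (X : Type) (gen : X -> g) : free_lie_on gen ->
  forall y, exists x, qder_H2 x = y.
Proof.
move=> g_free y; have [z ->] := quot_class_surj y.
have zP : cocycle2 iota z by apply/asboolP/(Z2_valP z).
have [q qP qE] := cocycle_cohomologous_qder g_free zP.
have qI : q \in qder_pred eps by apply/asboolP.
exists (qder_class (Qder qI)); rewrite qder_H2_class.
apply/quot_modP/asboolP.
by rewrite [Z2_val _](raddfB (val : Z2 iota -> _)).
Qed.

End Comparison.

Theorem theorem1p4 (K : fieldType) (charK0 : [pchar K] =i pred0)
    (X : Type) (g : lieAlgType K) (gen : X -> g) (g_free : free_lie_on gen)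
    (U : algType K) (iota : {linear g -> U}) (U_env : enveloping_algebra iota)
    (eps : {lrmorphism U -> K^o}) (eps_aug : augmentation iota eps) :
  exists Phi : {linear qder_mod_exact eps -> H2 iota},
    bijective Phi /\
    forall q : qder eps,
      exists2 z : Z2 iota,
        z = (omega iota q, pairing_cochain iota (assoc_pairing q)) :> pair2 g U
        & Phi (qder_class q) = H2_class z.
Proof.
exists (qder_H2 U_env eps_aug); split.
  apply: inj_surj_bijective; first exact: qder_H2_inj.
  exact: qder_H2_surj g_free.
by move=> q; exists (qder_cochain U_env eps_aug q) => //; apply: qder_H2_class.
Qed.
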